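(* Let $G$ be a connected graph, and let $f:V(G)\to\{1,3,5,\ldots\}$ be a function. Then the following two statements hold. (i) $G$ has an $H_f$-factor for every admissible set-valued function $H_f$ with $|H_f^{-1}(f)|$ even if and only if $$\omega(G-S)\le f(S)+1 \quad\text{for all } S\subseteq V(G).$$ (ii) $G$ is $H_f$-critical for every admissible set-valued function $H_f$ with $|H_f^{-1}(f)|$ odd if and only if $$\omega(G-S)\le f(S) \quad\text{for all } \emptyset\ne S\subseteq V(G).$$
   Context: All graphs are finite and simple (no loops, no multiple edges). $V(G)$ is the vertex set of $G$, $\deg_F(v)$ is the degree of $v$ in $F$, $\omega(G)$ is the number of connected components of $G$ (the graph with no vertices has $0$ components), $G-S$ is the graph obtained from $G$ by deleting the vertices of $S$, and $f(S):=\sum_{x\in S}f(x)$. Given $f:V(G)\to\{1,3,5,\ldots\}$ (values are positive odd integers), let $2N=\max\{f(x):x\in V(G)\}+1$, an even integer. A set-valued function $H_f$ on $V(G)$ is called admissible if for each $v\in V(G)$ the set $H_f(v)$ is either $\{1,3,\ldots,f(v)\}$ (all odd integers from $1$ to $f(v)$) or $\{0,2,\ldots,2N\}$ (all even integers from $0$ to $2N$); the choice is made independently at each vertex, so for a given $f$ there are $2^{|V(G)|}$ such functions $H_f$. Write $H_f^{-1}(f):=\{v\in V(G): H_f(v)=\{1,3,\ldots,f(v)\}\}$. A spanning subgraph $F$ of $G$ is an $H_f$-factor of $G$ if $\deg_F(v)\in H_f(v)$ for all $v\in V(G)$. For a vertex $x$ of $G$, let $G^x$ be the graph obtained from $G$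 by adding one new vertex $x'$ together with the new edge $xx'$. Define the set-valued function $H_f^x$ on $V(G^x)$ by $H_f^x(x')=\{1\}$ and $H_f^x(v)=H_f(v)$ for $v\in V(G)$. An $H_f^x$-factor of $G^x$ is a spanning subgraph $F$ of $G^x$ with $\deg_F(v)\in H_f^x(v)$ for all $v\in V(G^x)$. The graph $G$ is $H_f$-critical if $G^x$ has an $H_f^x$-factor for every vertex $x$ of $G$. *)

(* Defs.v *)
(* MathComp, with finmap for finite sets of natural numbers. *)
From HB Require Import structures.
From mathcomp Require Import all_boot finmap.

Set Implicit Arguments.
Unset Strict Implicit.
Unset Printing Implicit Defensive.

Local Open Scope fset_scope.

Definition simple_graph (T : finType) (e : rel T) : Prop :=
  symmetric e /\ irreflexive e.

(* The empty graph has 0 components, so it does not count as connected. *)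
Definition connected_graph (T : finType) (e : rel T) : Prop :=
  0 < #|T| /\ forall x y : T, connect e x y.

Definition omega (T : finType) (e : rel T) : nat := n_comp e T.

Definition del_vertices (T : finType) (e : rel T) (S : {set T}) :
    rel {x : T | x \notin S} :=
  fun u v => e (val u) (val v).
Arguments del_vertices {T} e S.

Definition degree (T : finType) (F : rel T) (v : T) : nat :=
  #|[set u | F v u]|.

Definition spanning_subgraph (T : finType) (F e : rel T) : Prop :=
  simple_graph F /\ subrel F e.

Definition is_factor (T : finType) (e : rel T) (H : T -> {fset nat})
    (F : rel T) : Prop :=
  spanning_subgraph F e /\ forall v, degree F v \in H v.

Definition has_factor (T : finType) (e : rel T) (H : T -> {fset nat}) : Prop :=
  exists F : rel T, is_factor e H F.

Definition odds_upto (n : nat) : {fset nat} :=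
  [fset k in iota 0 n.+1 | odd k].

Definition evens_upto (n : nat) : {fset nat} :=
  [fset k in iota 0 n.+1 | ~~ odd k].

(* This is the number written 2N, not N. *)
Definition twoN (T : finType) (f : T -> nat) : nat := (\max_(x : T) f x).+1.

Definition admissible (T : finType) (f : T -> nat) (H : T -> {fset nat}) :
    Prop :=
  forall v, H v = odds_upto (f v) \/ H v = evens_upto (twoN f).

(* The set written $H_f^{-1}(f)$. *)
Definition odd_vertices (T : finType) (f : T -> nat) (H : T -> {fset nat}) :
    {set T} :=
  [set v | H v == odds_upto (f v)].

(* The graph $G^x$: [None] is the new vertex, adjacent exactly to [Some x]. *)
Definition pendant_graph (T : finType) (e : rel T) (x : T) : rel (option T) :=
  fun a b => match a, b with
             | Some u, Some v => e u v
             | Some u, None => u == x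
             | None, Some v => v == x
             | None, None => false
             end.

Definition pendant_H (T : finType) (H : T -> {fset nat}) (a : option T) :
    {fset nat} :=
  if a is Some v then H v else [fset 1].

Definition critical (T : finType) (e : rel T) (H : T -> {fset nat}) : Prop :=
  forall x : T, has_factor (pendant_graph e x) (pendant_H H).

(* Main.v *)
(* Both criteria reduce to one fact: if the capacities [h] have even sum and
   omega(G - S) <= h(S) + 1 for all S, then G has a spanning subgraph F with
   deg_F(v) <= h(v) and deg_F(v) = h(v) mod 2 for all v. For (i), h(v) is the
   maximum of H_f(v); for (ii) it is lowered by one at x, the edge xx' being
   forced. Such an F exists as soon as the graph with every vertex v blown up to
   a clique of size h(v) has a perfect matching: project the matching and count
   edges modulo 2. Perfect matchings come from a weak Tutte-Berge formula, in
   which G - S needs only as many components, whatever their parity, as S plus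
   the unmatched vertices; enlarge S by vertices missed by no maximum matching of
   G - S until none is left, then by Gallai's lemma two vertices missed by the
   same maximum matching lie in different components.
   Conversely, if omega(G - S) is too large, make H_f odd on S and at one vertex
   in each component of G - S (possibly sparing one component, for parity): each
   of these components must send an edge of the factor to S. *)
Require Import Defs.
From HB Require Import structures.
From mathcomp Require Import all_boot finmap zify.

Set Implicit Arguments.
Unset Strict Implicit.
Unset Printing Implicit Defensive.

(** The points moved by [m] pair off: [L] takes the one of smaller rank in each pair, and [m]
    carries [L] onto [R]. *)
Lemma odd_card_involution (T : finType) (A : {set T}) (m : T -> T) :
  involutive m -> {in A, forall x, m x \in A} ->
  odd #|A| = odd #|[set x in A | m x == x]|.
Proof.
move=> mK mA.
pose L := [set x in A | enum_rank x < enum_rank (m x)].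
pose R := [set x in A | enum_rank (m x) < enum_rank x].
have LR : R = m @: L.
  apply/setP=> x; apply/idP/imsetP => [|[y]].
    rewrite inE => /andP[xA lt]; exists (m x); last by rewrite mK.
    by rewrite inE mA //= mK.
  by rewrite !inE => /andP[yA lt] ->; rewrite mA //= mK.
have cLR : #|R| = #|L| by rewrite LR card_imset //; exact: inv_inj.
pose B := [set x | m x == x]; pose C := [set x | enum_rank x < enum_rank (m x)].
have -> : [set x in A | m x == x] = A :&: B by apply/setP=> x; rewrite !inE.
have EL : (A :\: B) :&: C = L.
  apply/setP=> x; rewrite !inE; case: eqP => [->|_]; last by case: (x \in A).
  by rewrite ltnn !andbF.
have ER : (A :\: B) :\: C = R.
  apply/setP=> x; rewrite !inE -leqNgt ltn_neqAle.
  rewrite (inj_eq val_inj) (inj_eq enum_rank_inj). by rewrite andbC -andbA andbCA.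
rewrite -(cardsID B A) -(cardsID C (A :\: B)) EL ER cLR.
by rewrite oddD addnn odd_double addbF.
Qed.

(** * Matchings, alternating walks and Gallai's lemma *)

Section Matching.
Variables (T : finType).
Implicit Types (e r : rel T) (S X : {set T}) (m : {ffun T -> T}).

(* A matching is encoded as the involution exchanging the ends of its edges;
   its fixed points are the unmatched vertices. *)
Definition matching r m : bool :=
  [forall x, (m (m x) == x) && ((m x != x) ==> r x (m x))].

Definition unmatched (m : T -> T) : {set T} := [set x | m x == x].

Definition maximum_matching r m : Prop :=
  matching r m /\ forall m', matching r m' -> #|unmatched m| <= #|unmatched m'|.

Lemma matchingP r m :
  reflect (involutive m /\ forall x, m x != x -> r x (m x)) (matching r m).
Proof.
apply: (iffP forallP) => [h|[mK me] x].
  split=> [x|x]; first by have /andP[/eqP] := h x.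
  by have /andP[_ /implyP] := h x; apply.
by rewrite mK eqxx; apply/implyP/me.
Qed.

Lemma matching_id r : matching r (finfun id).
Proof. by apply/forallP=> x; rewrite !ffunE !eqxx. Qed.

Lemma ex_maximum_matching r : exists m, maximum_matching r m.
Proof.
by case: (arg_minnP (fun m => #|unmatched m|) (matching_id r)) => m mm mn; exists m.
Qed.

Lemma odd_unmatched r m : matching r m -> odd #|unmatched m| = odd #|T|.
Proof.
move=> /matchingP[mK _].
have mT : {in [set: T], forall x, m x \in [set: T]} by move=> x; rewrite !inE.
rewrite -cardsT (odd_card_involution mK mT).
by congr (odd #|pred_of_set _|); apply/setP=> x; rewrite !inE.
Qed.

Definition swap_on (P : {set T}) (m1 m2 : {ffun T -> T}) : {ffun T -> T} :=
  [ffun x => if x \in P then m2 x else m1 x].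

Lemma swap_on_matching r (P : {set T}) m1 m2 :
  {in P, forall x, m1 x \in P} -> {in P, forall x, m2 x \in P} ->
  matching r m1 -> matching r m2 -> matching r (swap_on P m1 m2).
Proof.
move=> P1 P2 /matchingP[K1 e1] /matchingP[K2 e2]; apply/matchingP; split=> x.
  rewrite !ffunE; case: (boolP (x \in P)) => xP; first by rewrite P2 ?K2.
  suff /negPf-> : m1 x \notin P by rewrite K1.
  by apply: contra xP => /P1; rewrite K1.
by rewrite !ffunE; case: ifP => _; [apply: e2 | apply: e1].
Qed.

Lemma card_unmatched_swap_on (P : {set T}) m1 m2 :
  #|unmatched (swap_on P m1 m2)| + #|unmatched m1 :&: P| =
  #|unmatched m1| + #|unmatched m2 :&: P|.
Proof.
rewrite -(cardsID P (unmatched (swap_on P m1 m2))) -(cardsID P (unmatched m1)).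
have -> : unmatched (swap_on P m1 m2) :&: P = unmatched m2 :&: P.
  by apply/setP=> x; rewrite !inE ffunE; case: (x \in P); rewrite ?andbF.
have -> : unmatched (swap_on P m1 m2) :\: P = unmatched m1 :\: P.
  by apply/setP=> x; rewrite !inE ffunE; case: (x \in P).
lia.
Qed.

(* If [m2] fixes [v], the alternating walk of [m1] and [m2] from [v] is the orbit
   of [v] under [m2 \o m1]; [m1] and [m2] act on the exponents as reflections. *)
Lemma alternating_orbit (m1 m2 : T -> T) (v : T) :
  involutive m1 -> involutive m2 -> m2 v = v ->
  exists P : {set T},
    [/\ v \in P, {in P, forall x, m1 x \in P}, {in P, forall x, m2 x \in P} &
      forall u, u \in P -> m1 u = u ->
        unmatched m1 :&: P = [set u] /\ unmatched m2 :&: P = [set v]].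
Proof.
move=> K1 K2 fv; pose s x := m2 (m1 x).
have injs : injective s by apply: inj_comp; apply: inv_inj.
pose n := order s v; have n0 : 0 < n by rewrite /n order_gt0.
have itn : iter n s v = v by apply: iter_order.
have m2s k x : m2 (iter k s x) = iter k (fun x => m1 (m2 x)) (m2 x).
  by elim: k => //= k <-; rewrite /s !K2.
have sK k x : iter k (fun x => m1 (m2 x)) (iter k s x) = x.
  elim: k x => // k IH x; rewrite iterSr iterS /s K2 K1; exact: IH.
have M2 k : k <= n -> m2 (iter k s v) = iter (n - k) s v.
  move=> kn; rewrite m2s fv -{1}itn -{1}(subnKC kn) iterD; exact: sK.
have M1 k : k < n -> m1 (iter k s v) = iter (n.-1 - k) s v.
  move=> kn; have : m2 (iter k.+1 s v) = iter (n - k.+1) s v by apply: M2.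
  by rewrite iterS /s K2 -/s => ->; congr (iter _ _ _); lia.
have inj k l : k < n -> l < n -> iter k s v = iter l s v -> k = l.
  by move=> kn ln E; rewrite -(findex_iter kn) -(findex_iter ln) E.
pose P := [set x | fconnect s v x].
have PP x : reflect (exists2 k, k < n & x = iter k s v) (x \in P).
  rewrite inE; apply: (iffP idP) => [c|[k _ ->]]; last exact: fconnect_iter.
  by exists (findex s v x); [exact: findex_max | rewrite iter_findex].
(* A fixed point sits at the centre of a reflection of the exponents. One of [m1] makes the orbit
   length odd and is unique; one of [m2] other than [v] would make it even. *)
have F1 k : k < n -> m1 (iter k s v) = iter k s v -> n = k.*2.+1.
  move=> kn; rewrite M1 // => /inj E.
  have := E _ kn; lia.
have F2 k : 0 < k -> k < n -> m2 (iter k s v) = iter k s v -> n = k.*2.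
  move=> k0 kn; rewrite M2 1?ltnW // => /inj E.
  have := E _ kn; lia.
exists P; split.
- by rewrite inE connect0.
- by move=> x /PP[k kn ->]; rewrite M1 // inE fconnect_iter.
- by move=> x /PP[k kn ->]; rewrite M2 1?ltnW // inE fconnect_iter.
move=> u /PP[k kn ->] /(F1 _ kn) nk; split; apply/setP=> x; rewrite in_setI !inE -/P.
  apply/andP/eqP => [[/eqP fx]|->]; last first.
    by rewrite fconnect_iter M1 // (_ : n.-1 - k = k) //; lia.
  have := PP x; rewrite inE => Px /Px[l ln E]; move: fx; rewrite E => /(F1 _ ln) nl.
  by congr (iter _ _ _); lia.
apply/andP/eqP => [[/eqP fx]|->]; last by rewrite fv connect0.
have := PP x; rewrite inE => Px /Px[l ln E]; move: fx; rewrite E.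
by case: l ln E => // l ln E /(F2 l.+1 isT ln); lia.
Qed.

(** Otherwise the edge between [x] and [y] could be added to the matching. *)
Lemma maximum_matching_adjacent r m x y :
  symmetric r -> irreflexive r -> maximum_matching r m ->
  r x y -> m x = x -> m y = y -> x = y.
Proof.
move=> rs ri [/matchingP[mK mr] mx] xy fx fy; apply/eqP/negPn/negP => nxy.
pose m' := [ffun z => if z == x then y else if z == y then x else m z].
have mne z w : m w = w -> z != w -> m z == w = false.
  by move=> fw zw; rewrite -{1}fw (inj_eq (inv_inj mK)) (negPf zw).
have mm' : matching r m'.
  apply/matchingP; split=> z; rewrite !ffunE; have [->|zx] := eqVneq z x.
  - by rewrite eq_sym (negPf nxy) eqxx.
  - have [->|zy] := eqVneq z y; first by rewrite eqxx.
    by rewrite !mne // mK.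
  - by rewrite xy.
  - by have [->|zy] := eqVneq z y; [rewrite rs xy | apply: mr].
have := mx _ mm'; apply/negP; rewrite -ltnNge; apply: proper_card.
apply/properP; split; last first.
  by exists x; rewrite !inE ?fx // ffunE eqxx eq_sym.
apply/subsetP=> z; rewrite !inE ffunE; have [->|zx] := eqVneq z x; first by rewrite fx.
by have [->|zy] := eqVneq z y; first by rewrite fy.
Qed.

(* Gallai's lemma: when every vertex is missed by some maximum matching, being
   missed by no common maximum matching is transitive. *)
Lemma gallai r m x y :
  symmetric r -> irreflexive r ->
  (forall v, exists2 m', maximum_matching r m' & m' v = v) ->
  connect r x y -> maximum_matching r m -> m x = x -> m y = y -> x = y.
Proof.
move=> rs ri miss /connectP[p pth yE].
elim/last_ind: p y m yE pth => [|p z IH] y m1; first by move=> /= ->.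
rewrite last_rcons rcons_path => -> {y} /andP[/IH{}IH rvz] max1 fx fz.
set v := last x p in IH rvz.
have [m2 max2 fv] := miss v.
have [fv1|nfv1] := eqVneq (m1 v) v.
  rewrite (IH v m1) //; exact: maximum_matching_adjacent max1 rvz _ _.
have [mm1 mx1] := max1; have [mm2 mx2] := max2.
have [K1 _] := matchingP _ _ mm1; have [K2 _] := matchingP _ _ mm2.
have [P [vP P1 P2 ends]] := alternating_orbit K1 K2 fv.
have v2 : v \in unmatched m2 :&: P by rewrite !inE fv eqxx.
(* If [m1] missed no vertex of the alternating walk, replacing [m2] by [m1] along it would leave
   fewer unmatched vertices than [m2], which is maximum. *)
have [u uP fu] : exists2 u, u \in P & m1 u = u.
  have [E|[u]] := set_0Vmem (unmatched m1 :&: P); last first.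
    by rewrite !inE => /andP[/eqP fu uP]; exists u.
  have := mx2 _ (swap_on_matching P2 P1 mm2 mm1).
  have := card_unmatched_swap_on P m2 m1; rewrite E cards0.
  have : 0 < #|unmatched m2 :&: P| by apply/card_gt0P; exists v.
  lia.
have [E1 E2] := ends _ uP fu.
(* The switch trades the missed vertex [u] for [v]. It still misses [x] or [z] if that vertex lies
   off the walk, and then [x] or [z] equals [v], which [m1] covers. So both lie on the walk, where
   [m1] misses only [u]. *)
have max3 : maximum_matching r (swap_on P m1 m2).
  split=> [|m' /mx1]; first exact: swap_on_matching.
  by have := card_unmatched_swap_on P m1 m2; rewrite E1 E2 !cards1; lia.
have fv3 : swap_on P m1 m2 v = v by rewrite ffunE vP.
have [xP|xP] := boolP (x \in P); last first.
  have fx3 : swap_on P m1 m2 x = x by rewrite ffunE (negPf xP).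
  by have xv := IH v _ erefl max3 fx3 fv3; rewrite -xv fx eqxx in nfv1.
have [zP|zP] := boolP (z \in P); last first.
  have fz3 : swap_on P m1 m2 z = z by rewrite ffunE (negPf zP).
  have vz := maximum_matching_adjacent rs ri max3 rvz fv3 fz3.
  by rewrite vz fz eqxx in nfv1.
have : x \in [set u] by rewrite -E1 !inE fx eqxx.
have : z \in [set u] by rewrite -E1 !inE fz eqxx.
by rewrite !inE => /eqP-> /eqP.
Qed.

(** * Vertex deletion and the weak Tutte-Berge formula *)

Definition cut e S : rel T := fun x y => [&& e x y, x \notin S & y \notin S].

Definition separated e S X : Prop :=
  [disjoint X & S] /\ {in X &, forall x y, connect (cut e S) x y -> x = y}.

Lemma cut_sym e S : symmetric e -> symmetric (cut e S).
Proof. by move=> es x y; rewrite /cut es; congr (_ && _); exact: andbC. Qed.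

(** Deleted vertices stay in the type as isolated vertices, so every matching of [cut e S] counts
    them as unmatched. *)
Lemma matching_cut_fix e S m x : matching (cut e S) m -> x \in S -> m x = x.
Proof.
move=> /matchingP[_ me] xS; apply/eqP; apply: contraTT (xS) => /me.
by case/and3P.
Qed.

Lemma matching_cut_sub e S S' m :
  S \subset S' -> matching (cut e S') m -> matching (cut e S) m.
Proof.
move=> SS' /matchingP[mK me]; apply/matchingP; split=> // x /me /and3P[ex xS yS].
by apply/and3P; split=> //; [apply: contra xS | apply: contra yS]; apply: (subsetP SS').
Qed.

(* Adding to [S] a vertex missed by no maximum matching of [G - S] raises the
   number of unmatched vertices by two, by parity. *)
Lemma ex_missable_set e S m :
  maximum_matching (cut e S) m ->
  exists S' m', [/\ maximum_matching (cut e S') m',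
    forall v, exists2 m'', maximum_matching (cut e S') m'' & m'' v = v &
    #|unmatched m| + 2 * #|S'| <= #|unmatched m'| + 2 * #|S|].
Proof.
have [k] := ubnP (#|T| - #|S|); elim: k S m => // k IH S m leSk max.
have [mm mx] := max.
have [/forallP miss|/forallPn[v nv]] := boolP [forall v, [exists m' : {ffun T -> T},
  [&& matching (cut e S) m', #|unmatched m'| == #|unmatched m| & m' v == v]]].
  exists S, m; split=> // v; have /existsP[m' /and3P[mm' /eqP cm' /eqP fv]] := miss v.
  by exists m' => //; split=> // m'' /mx; rewrite cm'.
have nofix m' : matching (cut e S) m' -> m' v = v -> #|unmatched m| < #|unmatched m'|.
  move=> mm' fv; rewrite ltn_neqAle mx // andbT; apply: contraNneq nv => E.
  by apply/existsP; exists m'; rewrite mm' E fv !eqxx.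
have vS : v \notin S.
  by apply/negP=> vS; have := nofix _ mm (matching_cut_fix mm vS); rewrite ltnn.
have cS : #|v |: S| = #|S|.+1 by rewrite cardsU1 vS.
have [m1 max1] := ex_maximum_matching (cut e (v |: S)).
have [mm1 _] := max1.
have := nofix _ (matching_cut_sub (subsetUr _ _) mm1) (matching_cut_fix mm1 (setU11 _ _)).
have := odd_unmatched mm; rewrite -(odd_unmatched mm1) => par lt.
have [|S' [m' [? ? le]]] := IH _ _ _ max1.
  have := max_card (mem (v |: S)); rewrite cS; lia.
by exists S', m'; split=> //; lia.
Qed.

Lemma tutte_berge e : symmetric e -> irreflexive e ->
  exists m S X, [/\ matching e m, separated e S X & #|unmatched m| + #|S| <= #|X|].
Proof.
move=> es ei; have [m max] := ex_maximum_matching (cut e set0).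
have [S [m' [max' miss le]]] := ex_missable_set max.
have [mm _] := max; have [mm' _] := max'.
(* All of [S] is unmatched by [m'], so this set has [#|unmatched m'| - #|S|] elements. *)
exists m, S, (unmatched m' :\: S); split.
- have /matchingP[mK me] := mm; apply/matchingP; split=> // x /me.
  by case/and3P.
- split; first by rewrite -setI_eq0 setIDAC setDIl setDv setI0.
  move=> x y; rewrite !inE => /andP[_ /eqP fx] /andP[_ /eqP fy] c.
  apply: (gallai _ _ miss c max') => //; first exact: cut_sym.
  by move=> z; rewrite /cut ei.
have : unmatched m' :&: S = S.
  by apply/setIidPr/subsetP=> x xS; rewrite inE (matching_cut_fix mm' xS).
move=> E; have := cardsID S (unmatched m'); rewrite E.
move: le; rewrite cards0; lia.
Qed.

(** The formula leaves at most one unmatched vertex, and parity excludes one. *)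
Lemma ex_perfect_matching e : symmetric e -> irreflexive e -> ~~ odd #|T| ->
  (forall S X, separated e S X -> #|X| <= #|S|.+1) ->
  exists2 m, matching e m & forall x, m x != x.
Proof.
move=> es ei ev tough; have [m [S [X [mm sep le]]]] := tutte_berge es ei.
exists m => // x; have := tough _ _ sep; have := odd_unmatched mm.
rewrite (negPf ev) => par lt; have /eqP : #|unmatched m| = 0 by lia.
by rewrite cards_eq0 => /eqP/setP/(_ x); rewrite !inE => ->.
Qed.

End Matching.

(** * The number of components as the largest size of a separated set *)

Section Components.
Variables (T : finType) (e : rel T) (S : {set T}).
Hypothesis es : symmetric e.

Lemma connect_del_vertices (u v : {x : T | x \notin S}) :
  connect (del_vertices e S) u v = connect (cut e S) (val u) (val v).
Proof.
apply/connectP/connectP=> [[p pth ->]|[p]].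
  exists (map val p); last by rewrite last_map.
  elim: p u pth => //= w p IH u /andP[uw /IH ->]; rewrite andbT.
  by apply/and3P; split; [exact: uw | exact: (valP u) | exact: (valP w)].
elim: p u => [|y p IH] u /= => [_ /val_inj ->|/andP[/and3P[uy _ yS] pth] vE].
  by exists [::].
have [q pq ->] := IH (Sub y yS) pth vE.
by exists (Sub y yS :: q); rewrite //= pq andbT.
Qed.

Let del_sym : connect_sym (del_vertices e S).
Proof. by apply: sym_connect_sym => x y; apply: es. Qed.

Lemma separated_card_le_omega X :
  separated e S X -> #|X| <= omega (del_vertices e S).
Proof.
case=> dis sep; pose Y : {set {x : T | x \notin S}} := [set u | val u \in X].
have -> : #|X| = #|Y|.
  rewrite -(card_imset (mem Y) val_inj); apply: eq_card => x.
  apply/idP/imsetP => [xX|[u]]; last by rewrite inE => ? ->.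
  have xS : x \notin S by rewrite (disjointFr dis xX).
  by exists (Sub x xS : {x : T | x \notin S}); rewrite ?inE.
rewrite -(card_in_imset (f := root (del_vertices e S))); last first.
  move=> u v; rewrite !inE => uX vX /eqP; rewrite root_connect // => c.
  by apply: val_inj; apply: sep => //; rewrite -connect_del_vertices.
apply: subset_leq_card; apply/subsetP => _ /imsetP[u _ ->].
by rewrite !inE roots_root.
Qed.

Lemma ex_separated_omega :
  exists2 X, separated e S X & #|X| = omega (del_vertices e S).
Proof.
pose Y := [set u in roots (del_vertices e S)].
exists (val @: Y); last first.
  rewrite (card_imset _ val_inj); apply: eq_card => u.
  by rewrite !inE andbT.
split; first by rewrite disjoint_subset; apply/subsetP => _ /imsetP[u _ ->]; exact: (valP u).
move=> _ _ /imsetP[u uY ->] /imsetP[v vY ->].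
rewrite -connect_del_vertices -root_connect //.
by move: uY vY; rewrite !inE => /eqP-> /eqP-> /eqP->.
Qed.

End Components.

Lemma odd_sum (I : finType) (F G : I -> nat) :
  (forall i, odd (F i) = odd (G i)) -> odd (\sum_i F i) = odd (\sum_i G i).
Proof.
move=> FG; rewrite !(big_morph odd oddD (erefl : odd 0 = false)).
by apply: eq_bigr.
Qed.

Lemma degreeE (T : finType) (F : rel T) v : degree F v = \sum_u F v u.
Proof. by rewrite /degree -sum1dep_card big_mkcond; apply: eq_bigr => u _; case: (F v u). Qed.

(** * Parity factors from perfect matchings of the blow-up *)

Section Blowup.
Variables (T : finType) (e : rel T) (h : T -> nat).
Hypotheses (es : symmetric e) (ei : irreflexive e).

Definition blowup : rel {v : T & 'I_(h v)} :=
  fun a b => (a != b) && ((tag a == tag b) || e (tag a) (tag b)).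

Lemma blowup_separated S' X' : separated blowup S' X' ->
  exists S X, [/\ separated e S X, #|X| = #|X'| & \sum_(v in S) h v <= #|S'|].
Proof.
case=> dis sep.
(* Only vertices whose whole clique is deleted count as deleted, those with [h v = 0] included at no
   cost. Any other vertex keeps a copy outside [S'], so walks avoiding [S] lift to the blow-up. *)
pose S := [set v | [forall i : 'I_(h v), Tagged (fun v => 'I_(h v)) i \in S']].
have tagS a : a \notin S' -> tag a \notin S.
  by apply: contra; rewrite inE => /forallP/(_ (tagged a)); case: a.
have lift a b : a \notin S' -> b \notin S' ->
    connect (cut e S) (tag a) (tag b) -> connect (cut blowup S') a b.
  move=> aS bS /connectP[p]; elim: p a aS => [|y p IH] a aS /=.
    move=> _ tE; have [->|nab] := eqVneq a b; first exact: connect0.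
    by apply: connect1; rewrite /cut /blowup aS bS nab tE eqxx.
  case/andP=> /and3P[ay _ yS] pth bE.
  have /forallPn[i iS] : ~~ [forall i : 'I_(h y), Tagged (fun v => 'I_(h v)) i \in S'].
    by move: yS; rewrite inE.
  apply: connect_trans (IH (Tagged (fun v => 'I_(h v)) i) iS pth bE).
  apply: connect1; rewrite /cut /blowup aS iS /= ay orbT !andbT.
  by apply/eqP=> E; rewrite E /= ei in ay.
have inX a : a \in X' -> a \notin S' by move=> aX; rewrite (disjointFr dis aX).
exists S, (tag @: X'); split.
- split; first by rewrite disjoint_subset; apply/subsetP => _ /imsetP[a aX ->]; exact/tagS/inX.
  move=> _ _ /imsetP[a aX ->] /imsetP[b bX ->] c.
  by congr tag; apply: sep => //; apply: lift => //; apply: inX.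
- apply: card_in_imset => a b aX bX tE.
  by apply: sep => //; apply: lift; rewrite ?inX // tE connect0.
rewrite (eq_bigr (fun v => \sum_(i : 'I_(h v)) 1)); last by move=> v _; rewrite sum1_card card_ord.
rewrite sig_big_dep /= sum1dep_card; apply/subset_leq_card/subsetP => -[v i].
by rewrite !inE andbT /= => /forallP/(_ i).
Qed.

Lemma ex_parity_factor : ~~ odd (\sum_v h v) ->
  (forall S, omega (del_vertices e S) <= \sum_(v in S) h v + 1) ->
  exists2 F, spanning_subgraph F e &
    forall v, degree F v <= h v /\ odd (degree F v) = odd (h v).
Proof.
move=> ev tough.
have cV : #|{: {v : T & 'I_(h v)}}| = \sum_v h v.
  by rewrite card_tagged sumnE big_map big_enum; apply: eq_bigr => v _; rewrite card_ord.
have [||||m /matchingP[mK me] mfix] := @ex_perfect_matching _ blowup.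
- by move=> a b; rewrite /blowup es eq_sym [tag a == _]eq_sym.
- by move=> a; rewrite /blowup eqxx.
- by rewrite cV.
- move=> S' X' /blowup_separated[S [X [sep <- le]]].
  by have := separated_card_le_omega es sep; have := tough S; lia.
(* The copies of [v] matched to copies of [u]: the multiplicity of the projected edge, or, for
   [u = v], twice the number of matching edges inside the clique. *)
pose A v u := [set a | (tag a == v) && (tag (m a) == u)].
have Asym v u : #|A v u| = #|A u v|.
  rewrite -(card_imset (mem (A v u)) (inv_inj mK)); apply: eq_card => a.
  apply/imsetP/idP => [[b]|]; first by rewrite !inE andbC => ? ->; rewrite mK.
  by rewrite inE andbC => aA; exists (m a); rewrite ?inE mK.
have Aeven v : odd #|A v v| = false.
  rewrite (odd_card_involution mK); last by move=> a; rewrite !inE mK andbC.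
  rewrite (_ : [set _ in _ | _] = set0) ?cards0 //.
  by apply/setP=> a; rewrite !inE (negPf (mfix a)) andbF.
have Asum v : \sum_u #|A v u| = h v.
  rewrite -[RHS]card_ord -sum1_card.
  transitivity (\sum_(u : T) \sum_(i : 'I_(h v) | tag (m (Tagged _ i)) == u) 1); last first.
    rewrite [RHS](partition_big (fun i => tag (m (Tagged _ i))) predT) //.
  apply: eq_bigr => u _; rewrite sum1dep_card.
  rewrite -(card_imset _ (f := fun i : 'I_(h v) => Tagged (fun v => 'I_(h v)) i)).
    apply: eq_card => -[w i]; rewrite !inE /=.
    apply/andP/imsetP => [[/eqP wv]|[j]]; first by subst w => tE; exists i; rewrite ?inE.
    by rewrite inE => tE E; split; [apply/eqP; exact: (congr1 tag E) | rewrite E].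
  by move=> i j /eqP; rewrite eq_Tagged => /eqP.
(* Reducing multiplicities modulo 2 keeps degree parities, and so does dropping the diagonal, since
   [A v v] has even size. *)
pose F v u := (v != u) && odd #|A v u|.
exists F.
  split; first by split=> [v u|v]; rewrite /F ?eqxx // Asym eq_sym.
  move=> v u /andP[vu od]; have /card_gt0P[a] : 0 < #|A v u| by case: #|_| od.
  rewrite inE => /andP[/eqP av /eqP mu]; have := me a (mfix a).
  by rewrite /blowup av mu (negPf vu) => /andP[].
move=> v; rewrite degreeE -[h v]Asum; split.
  by apply: leq_sum => u _; rewrite /F; case: (v != u) => //=; case: #|_| => //= n; case: odd.
apply: odd_sum => u; rewrite /F; have [->|_] := eqVneq v u; first by rewrite Aeven.
by rewrite /= oddb.
Qed.

End Blowup.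

(** * Necessity: edges that a factor must send to the deleted set *)

Section Necessity.
Variables (T : finType) (e : rel T) (S : {set T}).
Hypothesis es : symmetric e.

(** Reversal of ordered adjacent pairs is an involution, and without loops it has no fixed point. *)
Lemma handshake (F : rel T) (C : {set T}) : simple_graph F ->
  ~~ odd (\sum_(v in C) #|[set u in C | F v u]|).
Proof.
case=> Fs Fi; pose A := [set p : T * T | (p.1 \in C) && ((p.2 \in C) && F p.1 p.2)].
have -> : \sum_(v in C) #|[set u in C | F v u]| = #|A|.
  rewrite -sum1dep_card -(pair_big_dep (mem C) (fun v u => (u \in C) && F v u) (fun _ _ => 1)).
  by apply: eq_bigr => v _; rewrite sum1dep_card.
pose sw (p : T * T) := (p.2, p.1).
have swA : {in A, forall p, sw p \in A} by move=> p; rewrite !inE /= Fs andbCA.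
rewrite (@odd_card_involution _ _ sw _ swA); last by case.
rewrite (_ : [set _ in _ | _] = set0) ?cards0 //; apply/setP=> -[u v]; rewrite !inE /=.
by apply/negP=> /andP[/and3P[_ _ Fuv] /eqP[vu _]]; rewrite vu Fi in Fuv.
Qed.

(* A component of [G - S] meeting [X] has odd degree sum, so it sends an edge of
   [F] to [S]. *)
Lemma separated_card_le_degree (F : rel T) (X : {set T}) :
  spanning_subgraph F e -> separated e S X ->
  (forall v, v \notin S -> odd (degree F v) = (v \in X)) ->
  #|X| <= \sum_(v in S) degree F v.
Proof.
move=> [Fsg Fe] [dis sep] par; have [Fs Fi] := Fsg.
pose C x := [set y | connect (cut e S) x y].
pose N := \bigcup_(s in S) [set y | F s y].
have cs : connect_sym (cut e S) := sym_connect_sym (cut_sym S es).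
have XS x : x \in X -> x \notin S by move=> xX; rewrite (disjointFr dis xX).
have CS x y : x \in X -> y \in C x -> y \notin S.
  move=> xX; rewrite inE => /connectP[p]; elim/last_ind: p y => [|p z _] y /=.
    by move=> _ ->; apply: XS.
  by rewrite last_rcons rcons_path => /andP[_ /and3P[_ _ zS]] ->.
(* Without such a neighbour of [S], all edges of [F] at [C x] stay inside it. Its degree sum would
   then be even, yet [x] is its only vertex of odd degree. *)
have hit x : x \in X -> exists2 y, y \in C x & y \in N.
  move=> xX; apply/exists_inP; apply: contraT => /exists_inPn noN.
  have /negP[] := handshake (C x) Fsg.
  rewrite (eq_bigr (degree F)) => [|y yC]; last first.
    apply: eq_card => u; rewrite !inE; apply: andb_idl => Fyu.
    have uS : u \notin S.
      apply: contra (noN y yC) => uS; apply/bigcupP; exists u => //.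
      by rewrite inE Fs.
    move: (yC); rewrite inE => c; apply: connect_trans c _; apply: connect1.
    by rewrite /cut (Fe _ _ Fyu) uS (CS x).
  rewrite (big_morph odd oddD (erefl : odd 0 = false)).
  rewrite (bigD1 x) /=; last by rewrite inE connect0.
  rewrite par ?XS // xX big1 // => y /andP[yC nyx]; rewrite par ?(CS x) //.
  apply: contraNF nyx => yX; rewrite eq_sym; apply/eqP/sep => //.
  by move: yC; rewrite inE.
(* By [hit] the default is never taken on [X]; [g] is injective there because its values lie in
   different components. *)
pose g x := odflt x [pick y in C x | y \in N].
have gP x : x \in X -> g x \in C x /\ g x \in N.
  move=> xX; rewrite /g; case: pickP => [y /andP[]//|no].
  by have [y yC yN] := hit x xX; have := no y; rewrite yC yN.
apply: (@leq_trans #|N|).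
  rewrite -(card_in_imset (f := g) (D := mem X)).
    by apply: subset_leq_card; apply/subsetP=> _ /imsetP[x xX ->]; have [] := gP x xX.
  move=> x y xX yX E; apply: sep => //.
  have [] := gP x xX; have [] := gP y yX; rewrite -E !inE [connect _ y _]cs => cy _ cx _.
  exact: connect_trans cx cy.
apply: (big_ind2 (fun (A : {set T}) n => #|A| <= n)); first by rewrite cards0.
  by move=> A m B n Am Bn; apply: leq_trans (leq_card_setU A B) (leq_add Am Bn).
by [].
Qed.

(** * Admissible functions that expose a violating set *)

Variable f : T -> nat.

Lemma mem_odds_upto n k : (k \in odds_upto n) = odd k && (k <= n).
Proof. by rewrite !inE -[_ || _]/(k \in iota 0 n.+1) mem_iota ltnS andbC. Qed.

Lemma mem_evens_upto n k : (k \in evens_upto n) = ~~ odd k && (k <= n).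
Proof. by rewrite !inE -[_ || _]/(k \in iota 0 n.+1) mem_iota ltnS andbC. Qed.

Lemma odds_upto_neq_evens_upto m n : (evens_upto m == odds_upto n) = false.
Proof.
by apply/eqP => /fsetP/(_ 0); rewrite mem_odds_upto mem_evens_upto.
Qed.

Lemma ex_admissible_separated (b : bool) : 0 < omega (del_vertices e S) ->
  exists H X, [/\ admissible f H, odd #|odd_vertices f H| = b, separated e S X,
    omega (del_vertices e S) <= #|X|.+1 &
    forall v, H v = if v \in S :|: X then odds_upto (f v) else evens_upto (twoN f)].
Proof.
move=> om; have [X [dis sep] cX] := ex_separated_omega S es.
have [Y YX [le oY]] : exists2 Y : {set T}, Y \subset X & #|X| <= #|Y|.+1 /\ odd (#|S| + #|Y|) = b.
  have [E|ne] := eqVneq (odd (#|S| + #|X|)) b; first by exists X.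
  have [x xX] : exists x, x \in X by apply/card_gt0P; rewrite cX.
  (* Sparing one component flips the parity, whence the successor in the bound on the number of
     components. *)
  exists (X :\ x); first exact: subD1set.
  by move: ne; rewrite (cardsD1 x X) xX; case: b; lia.
pose H v := if v \in S :|: Y then odds_upto (f v) else evens_upto (twoN f).
have disY := disjointWl YX dis.
exists H, Y; split=> //; last by rewrite -cX.
- by move=> v; rewrite /H; case: ifP; [left | right].
- rewrite -oY; congr odd; rewrite -cardsUI [S :&: Y]setIC.
  move: disY; rewrite -setI_eq0 => /eqP->; rewrite cards0 addn0.
  apply: eq_card => v; rewrite inE /H; case: ifP => _; first exact: eqxx.
  exact: odds_upto_neq_evens_upto.
- split=> // x y xY yY; apply: sep; exact: (subsetP YX).
Qed.

End Necessity.

(** * Degrees in the graph with a pendant edge *)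

Section Pendant.
Variables (T : finType) (x : T).

Lemma degree_Some (F : rel (option T)) v :
  degree F (Some v) = degree (relpre Some F) v + F (Some v) None.
Proof.
rewrite !degreeE (bigD1 None) //= addnC; congr (_ + _).
rewrite (reindex_omap Some id) => [|[]//]; apply: eq_bigl => u.
by rewrite /= eqxx.
Qed.

Lemma degree_pendant (F : rel T) v :
  degree (pendant_graph F x) (Some v) = degree F v + (v == x).
Proof. by rewrite degree_Some. Qed.

Lemma degree_pendant_None (F : rel T) : degree (pendant_graph F x) None = 1.
Proof.
rewrite /degree -(cards1 (Some x)); apply: eq_card => -[u|]; rewrite !inE //.
Qed.

End Pendant.

(** * Admissible sets as a bound together with a parity *)

Section Capacity.
Variables (T : finType) (f : T -> nat) (H : T -> {fset nat}).
Hypotheses (hf : forall v, odd (f v)) (adm : admissible f H).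

Definition capacity v := if H v == odds_upto (f v) then f v else twoN f.

(** The vertex [v] ensures that the maximum is attained, hence odd; over an empty type [twoN f]
    would be 1. *)
Lemma odd_twoN (v : T) : odd (twoN f) = false.
Proof.
have T0 : 0 < #|T| by apply/card_gt0P; exists v.
by rewrite /twoN /=; have [w ->] := eq_bigmax f T0; rewrite hf.
Qed.

Lemma odd_capacity v : odd (capacity v) = (v \in odd_vertices f H).
Proof. by rewrite inE /capacity; case: ifP => _; rewrite ?hf ?(odd_twoN v). Qed.

Lemma leq_capacity v : f v <= capacity v.
Proof. by rewrite /capacity; case: ifP => // _; apply/leqW/leq_bigmax. Qed.

Lemma mem_admissible v k :
  (k \in H v) = (odd k == odd (capacity v)) && (k <= capacity v).
Proof.
rewrite /capacity; have [->|->] := adm v.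
  by rewrite eqxx hf eqb_id mem_odds_upto.
by rewrite odds_upto_neq_evens_upto (odd_twoN v) eqbF_neg mem_evens_upto.
Qed.

Lemma odd_sum_capacity : odd (\sum_v capacity v) = odd #|odd_vertices f H|.
Proof.
rewrite -sum1_card [in RHS]big_mkcond; apply: odd_sum => v.
by rewrite odd_capacity; case: (v \in _).
Qed.

End Capacity.

(** * The two criteria *)

Theorem theorem6 (T : finType) (e : rel T) (he : simple_graph e)
    (hconn : connected_graph e) (f : T -> nat) (hf : forall v, odd (f v)) :
  ((forall H : T -> {fset nat}, admissible f H ->
      ~~ odd #|odd_vertices f H| -> has_factor e H)
   <-> (forall S : {set T},
          omega (del_vertices e S) <= \sum_(x in S) f x + 1))
  /\
  ((forall H : T -> {fset nat}, admissible f H ->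
      odd #|odd_vertices f H| -> critical e H)
   <-> (forall S : {set T}, S != set0 ->
          omega (del_vertices e S) <= \sum_(x in S) f x)).
Proof.
have [es ei] := he.
have om0 : omega (del_vertices e set0) <= 1.
  have [X [_ sep] <-] := ex_separated_omega set0 es.
  apply/card_le1_eqP => x y xX yX; apply: sep => //.
  rewrite (@eq_connect _ _ e) => [|u v]; last by rewrite /cut !inE !andbT.
  by case: hconn.
split; split.
- move=> factors S; rewrite addn1.
  have [->//|om] := posnP (omega (del_vertices e S)).
  have [H [X [adm /negbT ev sep le HE]]] := ex_admissible_separated es f false om.
  have [F [Fe Fdeg]] := factors H adm ev.
  have par v : v \notin S -> odd (degree F v) = (v \in X).
    move=> vS; have := Fdeg v; rewrite HE inE (negPf vS) /=.
    by case: ifP => _; rewrite ?mem_odds_upto ?mem_evens_upto => /andP[] // /negbTE.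
  apply: leq_trans le _; rewrite ltnS; apply: leq_trans (separated_card_le_degree es Fe sep par) _.
  apply: leq_sum => v vS; have := Fdeg v.
  by rewrite HE inE vS mem_odds_upto => /andP[].
- move=> tough H adm ev.
  have [||F Fe Fdeg] := @ex_parity_factor T e (capacity f H) es ei.
  + by rewrite odd_sum_capacity.
  + move=> S; apply: leq_trans (tough S) _; rewrite leq_add2r.
    by apply: leq_sum => v _; apply: leq_capacity.
  exists F; split=> // v; have [le par] := Fdeg v.
  by rewrite (mem_admissible hf adm) par eqxx.
- move=> crit S /set0Pn[x xS].
  have [->//|om] := posnP (omega (del_vertices e S)).
  have [H [X [adm od sep le HE]]] := ex_admissible_separated es f true om.
  have [F [[[Fs Fi] Fe] Fdeg]] := crit H adm od x.
  pose F' := relpre Some F.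
  have F'e : spanning_subgraph F' e.
    by split=> [|u v /Fe]; [split=> [u v|u]; [exact: Fs | exact: Fi] |].
  have FN v : F (Some v) None -> v = x by move=> /Fe /eqP.
  have Fx : F (Some x) None.
    have := Fdeg None; rewrite /= inE => /eqP deg1.
    have /card_gt0P[[u|]] : 0 < #|[set u | F None u]| by rewrite -/(degree F None) deg1.
      by rewrite inE Fs => Fu; rewrite -(FN u Fu).
    by rewrite inE Fi.
  (* As [x] lies in [S], removing the pendant edge changes no degree outside [S]. *)
  have par v : v \notin S -> odd (degree F' v) = (v \in X).
    move=> vS; have := Fdeg (Some v); rewrite degree_Some /= HE inE (negPf vS) /=.
    rewrite (_ : F (Some v) None = false) ?addn0; last first.
      by apply: contraNF vS => /FN->.
    by case: ifP => _; rewrite ?mem_odds_upto ?mem_evens_upto => /andP[] // /negbTE.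
  apply: leq_trans le _; have := separated_card_le_degree es F'e sep par.
  rewrite -ltnS => /leq_trans; apply.
  have deg v : v \in S -> degree F' v + F (Some v) None <= f v.
    by move=> vS; have := Fdeg (Some v); rewrite degree_Some /= HE inE vS mem_odds_upto => /andP[].
  (* The pendant edge uses one unit of [f x], so the degrees of [F'] on [S] sum to less than [f(S)];
     this pays for the spared component. *)
  rewrite (bigD1 x) //= [leqRHS](bigD1 x) //= -addSn; apply: leq_add.
    by have := deg x xS; rewrite Fx addn1.
  apply: leq_sum => v /andP[vS _]; apply: leq_trans (deg v vS); exact: leq_addr.
- move=> tough H adm od x.
  have f0 v : 0 < f v by have := hf v; case: (f v).
  have cap0 v : 0 < capacity f H v := leq_trans (f0 v) (leq_capacity f H v).
  (* One unit at [x] is reserved for the pendant edge. Capacities are positive, so the truncated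
     subtraction is exact. *)
  pose h v := capacity f H v - (v == x).
  have hE v : h v + (v == x) = capacity f H v.
    by rewrite subnK //; case: (v == x); rewrite ?cap0.
  have hsum (S : {set T}) : \sum_(v in S) h v + (x \in S) = \sum_(v in S) capacity f H v.
    rewrite -(eq_bigr _ (fun v _ => hE v)) big_split /=; congr (_ + _).
    have [xS|xS] := boolP (x \in S); last first.
      by rewrite big1 // => v vS; case: eqP vS xS => // -> ->.
    by rewrite (bigD1 x) //= eqxx big1 // => v /andP[_ /negbTE->].
  have [||F [Fsg Fe] Fdeg] := @ex_parity_factor T e h es ei.
  + have sumT g : \sum_(v in [set: T]) g v = \sum_v g v by apply: eq_bigl => v; rewrite inE.
    have := odd_sum_capacity H hf; rewrite od -sumT -hsum sumT in_setT oddD.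
    by case: odd.
  (* For empty [S] connectivity gives the bound; otherwise the [+ 1] absorbs the unit lost at
     [x]. *)
  + move=> S; have [->|S0] := eqVneq S set0; first by rewrite big_set0.
    have le : \sum_(v in S) f v <= \sum_(v in S) capacity f H v.
      by apply: leq_sum => v _; apply: leq_capacity.
    apply: leq_trans (tough S S0) (leq_trans le _).
    by rewrite -hsum leq_add2l; case: (x \in S).
  have [Fs Fi] := Fsg.
  exists (pendant_graph F x); split.
    split; last by case=> [u|] [v|] //=; apply: Fe.
    by split=> [[u|] [v|]|[u|]] //=; rewrite ?Fi // Fs.
  case=> [v|]; last by rewrite degree_pendant_None inE.
  have [le par] := Fdeg v.
  rewrite degree_pendant /= (mem_admissible hf adm) -hE !oddD par eqxx.
  by rewrite leq_add2r.
Qed.
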